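(* Let $(M,\omega)$ be a symplectic manifold with $H^1(M,\mathbb{R})=0$, and let $L$ be a hermitian complex line bundle on $M$ with $c_1(L)=[\omega]$. Suppose we are given a real polarization of $M$. Then the Bohr-Sommerfeld quantization of $(M,\omega,L,\nabla)$ with this real polarization is independent of the choice of the unitary connection $\nabla$ on $L$ for which $(M,\omega,L,\nabla)$ is a prequantum system. That is, if $\nabla$ and $\nabla'$ are unitary connections on $L$ such that $(M,\omega,L,\nabla)$ and $(M,\omega,L,\nabla')$ are both prequantum systems, then their Bohr-Sommerfeld quantizations associated to the given real polarization coincide.
   Context: A prequantum system is a quadruple $(M,\omega,L,\nabla)$ where $(M,\omega)$ is a symplectic manifold, $\pi:L\to M$ is a complex line bundle, and $\nabla$ is a connection on $L$ with $\operatorname{curv}(\nabla)=\omega$. Here $\operatorname{curv}$ is normalized as $\operatorname{curv}(\nabla)=\frac{i}{2\pi}F_\nabla$, where $F_\nabla\in\Omega^2(M,\mathbb{C})$ is the usual curvature 2-form of $\nabla$; the equality $c_1(L)=[\omega]$ is in $H^2(M,\mathbb{R})$. A unitary connection is one preserving the hermitian metric of $L$. A real polarization of $M$ is a foliation of $M$ by Lagrangian submanifolds. A Lagrangian leaf $\Lambda$ is integral for $(M,\omega,L,\nabla)$ if $(L,\nabla)|_\Lambda$ is trivial as a bundle with connection, i.e. isomorphic to $\Lambda\times\mathbb{C}$ with the trivial connection $d$. The Bohr-Sommerfeld quantization of $(M,\omega,L,\nabla)$ associated to a real polarization is the complex vector space generated by (i.e. with basis) the set of integral leaves of the foliation. 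*)

(* Defs.v *)
From mathcomp Require Import all_boot all_order all_algebra.
From mathcomp Require Import all_classical all_reals all_analysis.
From mathcomp Require Import complex.
Set Implicit Arguments.
Unset Strict Implicit.
Unset Printing Implicit Defensive.
Import Order.TTheory GRing.Theory Num.Theory.
Import numFieldNormedType.Exports.
Local Open Scope classical_set_scope.
Local Open Scope ring_scope.
Local Open Scope complex_scope.

(** * Smooth maps between Euclidean spaces *)

(* k-fold differentiability on U, which is open in every use below *)
Fixpoint diff_n (R : realType) (n : nat) (V : normedModType R) (k : nat)
    (U : set 'rV[R]_n) (f : 'rV[R]_n -> V) : Prop :=
  if k is k'.+1 then
    (forall x, U x -> differentiable f x) /\
    (forall v, diff_n k' U ('D_v f))
  else True.

Definition smooth (R : realType) (n : nat) (V : normedModType R)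
    (U : set 'rV[R]_n) (f : 'rV[R]_n -> V) : Prop :=
  forall k, diff_n k U f.

(** * Manifolds *)

(* Both maps are total functions; only their values on [cdom] and on
   [cmap @` cdom] are meaningful. *)
Record chart (R : realType) (n : nat) (T : Type) := Chart {
  cdom : set T;
  cmap : T -> 'rV[R]_n;
  cinv : 'rV[R]_n -> T }.

Definition cimg (R : realType) n T (c : chart R n T) : set 'rV[R]_n :=
  cmap c @` cdom c.

Definition is_chart (R : realType) n (T : topologicalType) (c : chart R n T) :=
  [/\ open (cdom c) /\ open (cimg c),
      forall p, cdom c p -> cinv c (cmap c p) = p,
      forall p, cdom c p -> {for p, continuous (cmap c)} &
      forall x, cimg c x -> {for x, continuous (cinv c)}].

Definition smooth_transition (R : realType) n (T : topologicalType)
    (c c' : chart R n T) : Prop :=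
  smooth (cmap c @` (cdom c `&` cdom c')) (cmap c' \o cinv c).

(* [chart_at p] is an arbitrary preferred chart around p; it is used to
   coordinatize tangent spaces. *)
Record manifold (R : realType) (n : nat) := Manifold {
  carrier :> topologicalType;
  atlas : set (chart R n carrier);
  chart_at : carrier -> chart R n carrier;
  manifold_hausdorff : hausdorff_space carrier;
  manifold_second_countable : @second_countable carrier;
  atlas_chart : forall c, atlas c -> is_chart c;
  atlas_compat : forall c c', atlas c -> atlas c' -> smooth_transition c c';
  chart_at_atlas : forall p, atlas (chart_at p);
  chart_at_dom : forall p, cdom (chart_at p) p }.
Arguments atlas {R n} m.
Arguments chart_at {R n m} p.

Definition maximal_atlas (R : realType) n (M : manifold R n)
    (c : chart R n M) : Prop :=
  is_chart c /\
  (forall c', atlas M c' -> smooth_transition c c' /\ smooth_transition c' c).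
Arguments maximal_atlas {R n} M c.

Definition smooth_on (R : realType) n (M : manifold R n) (U : set M)
    (f : M -> R) : Prop :=
  forall c, atlas M c -> smooth (cmap c @` (U `&` cdom c)) (f \o cinv c).

Definition csmooth_on (R : realType) n (M : manifold R n) (U : set M)
    (f : M -> R[i]) : Prop :=
  smooth_on U (fun p => complex.Re (f p)) /\ smooth_on U (fun p => complex.Im (f p)).

(* The tangent space of M at p is 'rV[R]_n, a vector being represented by its
   components in the chart [chart_at p]. The differential of f at p: *)
Definition dfun (R : realType) n (M : manifold R n) (f : M -> R) (p : M)
    (v : 'rV[R]_n) : R :=
  'D_v (f \o cinv (chart_at p)) (cmap (chart_at p) p).

Definition cdfun (R : realType) n (M : manifold R n) (f : M -> R[i]) (p : M)
    (v : 'rV[R]_n) : R[i] :=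
  dfun (fun q => complex.Re (f q)) p v +i* dfun (fun q => complex.Im (f q)) p v.

(* The vector field on [cdom c] with constant components v in the chart c.
   When c = chart_at p, its value at p is v itself. *)
Definition coord_field (R : realType) n (M : manifold R n) (c : chart R n M)
    (v : 'rV[R]_n) (p : M) : 'rV[R]_n :=
  'D_v (cmap (chart_at p) \o cinv c) (cmap c p).

Definition smooth_map (R : realType) m n (N : manifold R m) (M : manifold R n)
    (f : N -> M) : Prop :=
  continuous f /\
  (forall c c', atlas N c -> atlas M c' ->
     smooth (cmap c @` (cdom c `&` (f @^-1` cdom c')))
            (cmap c' \o f \o cinv c)).

Definition dmap (R : realType) m n (N : manifold R m) (M : manifold R n)
    (f : N -> M) (q : N) (w : 'rV[R]_m) : 'rV[R]_n :=
  'D_w (cmap (chart_at (f q)) \o f \o cinv (chart_at q)) (cmap (chart_at q) q).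

Definition immersion (R : realType) m n (N : manifold R m) (M : manifold R n)
    (f : N -> M) : Prop :=
  smooth_map f /\ (forall q, injective (dmap f q)).

(** * Differential forms of degree 1 and 2, de Rham cohomology *)

Record form1 (R : realType) n (M : manifold R n) := Form1 {
  form1_fun :> M -> 'rV[R]_n -> R;
  form1_linear : forall p a u v,
    form1_fun p (a *: u + v) = a * form1_fun p u + form1_fun p v;
  form1_smooth : forall c v, atlas M c ->
    smooth_on (cdom c) (fun p => form1_fun p (coord_field c v p)) }.

Record form2 (R : realType) n (M : manifold R n) := Form2 {
  form2_fun :> M -> 'rV[R]_n -> 'rV[R]_n -> R;
  form2_linearl : forall p a u v w,
    form2_fun p (a *: u + v) w = a * form2_fun p u w + form2_fun p v w;
  form2_linearr : forall p a u v w,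
    form2_fun p w (a *: u + v) = a * form2_fun p w u + form2_fun p w v;
  form2_alt : forall p v, form2_fun p v v = 0;
  form2_smooth : forall c v w, atlas M c ->
    smooth_on (cdom c)
      (fun p => form2_fun p (coord_field c v p) (coord_field c w p)) }.

(* Exterior derivatives at p are given by Cartan's formula, the arguments
   being extended to the coordinate fields of [chart_at p]; these commute, so
   the terms with Lie brackets vanish. *)
Definition extd1 (R : realType) n (M : manifold R n) (alpha : form1 M) (p : M)
    (u v : 'rV[R]_n) : R :=
  let X w := coord_field (chart_at p) w in
  dfun (fun q => alpha q (X v q)) p u - dfun (fun q => alpha q (X u q)) p v.

Definition extd2 (R : realType) n (M : manifold R n) (omega : form2 M) (p : M)
    (u v w : 'rV[R]_n) : R :=
  let X z := coord_field (chart_at p) z in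
  dfun (fun q => omega q (X v q) (X w q)) p u
  - dfun (fun q => omega q (X u q) (X w q)) p v
  + dfun (fun q => omega q (X u q) (X v q)) p w.

Definition closed1 (R : realType) n (M : manifold R n) (alpha : form1 M) :=
  forall p u v, extd1 alpha p u v = 0.

Definition exact1 (R : realType) n (M : manifold R n) (alpha : form1 M) :=
  exists2 f : M -> R, smooth_on setT f &
    forall p v, alpha p v = dfun f p v.

Definition H1_zero (R : realType) n (M : manifold R n) : Prop :=
  forall alpha : form1 M, closed1 alpha -> exact1 alpha.

Definition closed2 (R : realType) n (M : manifold R n) (eta : form2 M) :=
  forall p u v w, extd2 eta p u v w = 0.

Definition cohomologous2 (R : realType) n (M : manifold R n)
    (eta eta' : form2 M) : Prop :=
  exists alpha : form1 M,
    forall p u v, eta p u v - eta' p u v = extd1 alpha p u v.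

Definition symplectic (R : realType) n (M : manifold R n) (omega : form2 M) :=
  closed2 omega /\
  (forall p u, (forall v, omega p u v = 0) -> u = 0).

(** * Complex line bundles *)

(* Fibres with local trivializations. As for charts, [triv j p] and
   [trivinv j p] are meaningful only for p in [tdom j]. No smoothness yet. *)
Record preline (R : realType) n (M : manifold R n) := PreLine {
  fib :> M -> lmodType R[i];
  tidx : Type;
  tdom : tidx -> set M;
  triv : tidx -> forall p, fib p -> R[i];
  trivinv : tidx -> forall p, R[i] -> fib p;
  triv_at : M -> tidx }.
Arguments tidx {R n M} _.
Arguments tdom {R n M _} _.
Arguments triv {R n M _} _ _ _.
Arguments trivinv {R n M _} _ _ _.
Arguments triv_at {R n M} _ _.

Record is_line_bundle (R : realType) n (M : manifold R n) (L : preline M) :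
    Prop := IsLineBundle {
  tdom_open : forall j : tidx L, open (tdom j);
  triv_at_dom : forall p, tdom (triv_at L p) p;
  triv_linear : forall (j : tidx L) p, tdom j p -> forall a (x y : L p),
    triv j p (a *: x + y) = a * triv j p x + triv j p y;
  trivK : forall (j : tidx L) p, tdom j p ->
    cancel (triv j p) (trivinv j p);
  trivinvK : forall (j : tidx L) p, tdom j p ->
    cancel (trivinv j p) (triv j p);
  triv_smooth : forall j j' : tidx L,
    csmooth_on (tdom j `&` tdom j') (fun p => triv j' p (trivinv j p 1)) }.

Record line_bundle (R : realType) n (M : manifold R n) := LineBundle {
  line_pre :> preline M;
  line_ax : is_line_bundle line_pre }.

Notation section L := (forall p, fib L p).

Definition smooth_section (R : realType) n (M : manifold R n) (L : preline M)
    (U : set M) (s : section L) : Prop :=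
  forall j : tidx L, csmooth_on (U `&` tdom j) (fun p => triv j p (s p)).

Record hermitian_metric (R : realType) n (M : manifold R n)
    (L : line_bundle M) := Hermitian {
  herm :> forall p, L p -> L p -> R[i];
  herm_linear : forall p a (x y z : L p),
    herm (a *: x + y) z = a * herm x z + herm y z;
  herm_conj : forall p (x y : L p), herm y x = (herm x y)^*;
  herm_pos : forall p (x : L p), x != 0 -> 0 < herm x x;
  herm_smooth : forall U (s t : section L), open U ->
    smooth_section U s -> smooth_section U t ->
    csmooth_on U (fun p => herm (s p) (t p)) }.

(** * Connections *)

(* A connection acts on sections over open sets: [nabla s p v] is the
   covariant derivative of s at p along v. It is meaningful only if s is
   smooth near p, and then depends only on the germ of s at p. *)
Record connection (R : realType) n (M : manifold R n) (L : line_bundle M) :=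
    Connection {
  nabla :> section L -> forall p, 'rV[R]_n -> L p;
  nabla_local : forall U (s t : section L) p v, open U -> U p ->
    smooth_section U s -> (forall q, U q -> s q = t q) ->
    nabla s p v = nabla t p v;
  nabla_linear : forall U (s : section L) p (a : R) u v, open U -> U p ->
    smooth_section U s ->
    nabla s p (a *: u + v) = a%:C *: nabla s p u + nabla s p v;
  nabla_add : forall U (s t : section L) p v, open U -> U p ->
    smooth_section U s -> smooth_section U t ->
    nabla (fun q => s q + t q) p v = nabla s p v + nabla t p v;
  nabla_leibniz : forall U (f : M -> R[i]) (s : section L) p v,
    open U -> U p -> csmooth_on U f -> smooth_section U s ->
    nabla (fun q => f q *: s q) p v = cdfun f p v *: s p + f p *: nabla s p v;
  nabla_smooth : forall U (s : section L) c v, open U -> atlas M c ->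
    smooth_section U s ->
    smooth_section (U `&` cdom c) (fun p => nabla s p (coord_field c v p)) }.

Definition unitary (R : realType) n (M : manifold R n) (L : line_bundle M)
    (h : hermitian_metric L) (D : connection L) : Prop :=
  forall U (s t : section L) p v, open U -> U p ->
    smooth_section U s -> smooth_section U t ->
    cdfun (fun q => h q (s q) (t q)) p v =
    h p (D s p v) (t p) + h p (s p) (D t p v).

(* F(u, v) s at p, computed with the coordinate fields of [chart_at p]
   extending u and v, whose Lie bracket vanishes *)
Definition curvature (R : realType) n (M : manifold R n) (L : line_bundle M)
    (D : connection L) (s : section L) (p : M) (u v : 'rV[R]_n) : L p :=
  let X w := coord_field (chart_at p) w in
  D (fun q => D s q (X v q)) p u - D (fun q => D s q (X u q)) p v.

(* (i / 2 pi) F_D = eta *)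
Definition curv_eq (R : realType) n (M : manifold R n) (L : line_bundle M)
    (D : connection L) (eta : form2 M) : Prop :=
  forall U (s : section L) p u v, open U -> U p -> smooth_section U s ->
    ((0 +i* 1) / (2 * pi)%:C) *: curvature D s p u v = (eta p u v)%:C *: s p.

(* c_1(L) = [omega] in H^2(M, R), where c_1(L) is the Chern-Weil class, i.e.
   the de Rham class of curv(D) for any D whose curv(D) is real *)
Definition c1_eq (R : realType) n (M : manifold R n) (L : line_bundle M)
    (omega : form2 M) : Prop :=
  exists (D : connection L) (eta : form2 M),
    curv_eq D eta /\ cohomologous2 eta omega.

Definition prequantum (R : realType) n (M : manifold R n) (omega : form2 M)
    (L : line_bundle M) (D : connection L) : Prop :=
  symplectic omega /\ curv_eq D omega.

(** * Triviality of a line bundle with connection along an immersion *)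

Definition pullback (R : realType) m n (N : manifold R m) (M : manifold R n)
    (f : N -> M) (L : preline M) : preline N :=
  @PreLine R m N (fun q => L (f q)) (tidx L) (fun j => f @^-1` tdom j)
    (fun j q => triv j (f q)) (fun j q => trivinv j (f q))
    (fun q => triv_at L (f q)).

(* With e the local frame of L given by a trivialization around f q, a section
   of the pullback is g (e \o f), and its covariant derivative along w is
   dg(w) e(f q) + g(q) D_(df w) e. *)
Definition pullback_connection (R : realType) m n (N : manifold R m)
    (M : manifold R n) (f : N -> M) (L : line_bundle M) (D : connection L)
    (s : section (pullback f L)) (q : N) (w : 'rV[R]_m) : pullback f L q :=
  let j := triv_at L (f q) in
  let e : section L := fun p => trivinv j p 1 in
  let g := fun r => triv j (f r) (s r) in
  cdfun g q w *: e (f q) + g q *: D e (f q) (dmap f q w).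

Definition trivial_line (R : realType) m (N : manifold R m) : preline N :=
  @PreLine R m N (fun=> (R[i]^o : lmodType R[i])) unit (fun=> setT)
    (fun _ _ => id) (fun _ _ => id) (fun=> tt).

Definition trivial_connection (R : realType) m (N : manifold R m)
    (s : section (trivial_line N)) (q : N) (w : 'rV[R]_m) : trivial_line N q :=
  cdfun s q w.

Definition isomorphic_with_connection (R : realType) m (N : manifold R m)
    (E E' : preline N)
    (D : section E -> forall q, 'rV[R]_m -> E q)
    (D' : section E' -> forall q, 'rV[R]_m -> E' q) : Prop :=
  exists Phi : forall q, E q -> E' q,
    [/\ forall q a (x y : E q), Phi q (a *: x + y) = a *: Phi q x + Phi q y,
        forall q, bijective (Phi q),
        forall U (s : section E), open U ->
          smooth_section U s <-> smooth_section U (fun q => Phi q (s q)) &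
        forall U (s : section E) q w, open U -> U q -> smooth_section U s ->
          Phi q (D s q w) = D' (fun r => Phi r (s r)) q w].

Definition trivial_along (R : realType) m n (N : manifold R m)
    (M : manifold R n) (f : N -> M) (L : line_bundle M) (D : connection L) :=
  isomorphic_with_connection (@pullback_connection R m n N M f L D)
    (@trivial_connection R m N).

(** * Foliations and real polarizations *)

(* The chart has a cube as image, and each member of the family meets its
   domain in a countable (possibly empty) union of k-dimensional slices, given
   by constant values of the last n - k coordinates. *)
Definition flat_chart (R : realType) n k (M : manifold R n) (I : Type)
    (N : I -> manifold R k) (f : forall a, N a -> M) (c : chart R n M) : Prop :=
  [/\ maximal_atlas M c,
      exists lo hi : 'rV[R]_n,
        cimg c = [set x | forall i, lo 0 i < x 0 i < hi 0 i] &
      forall a, exists2 S : set 'rV[R]_n, countable S &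
        range (f a) `&` cdom c =
        [set p | cdom c p /\ exists2 y, S y &
           forall i : 'I_n, (k <= i)%N -> cmap c p 0 i = y 0 i]].

(* A partition of M into connected immersed k-dimensional submanifolds (the
   leaves), with a flat chart around each point. *)
Record foliation (R : realType) n (M : manifold R n) (k : nat) := Foliation {
  leaf : Type;
  leafM : leaf -> manifold R k;
  incl : forall a, leafM a -> M;
  leaf_nonempty : forall a, [set: leafM a] !=set0;
  leaf_connected : forall a, connected [set: leafM a];
  incl_injective : forall a, injective (@incl a);
  incl_immersion : forall a, immersion (@incl a);
  leaf_cover : forall p, exists a (q : leafM a), incl q = p;
  leaf_disjoint : forall a b (q : leafM a) (r : leafM b),
    incl q = incl r -> a = b;
  leaf_flat : forall p, exists2 c, flat_chart incl c & cdom c p }.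

Definition lagrangian (R : realType) n (M : manifold R n) (omega : form2 M)
    k (N : manifold R k) (f : N -> M) : Prop :=
  k.*2 = n /\ (forall q u v, omega (f q) (dmap f q u) (dmap f q v) = 0).

Definition real_polarization (R : realType) n (M : manifold R n)
    (omega : form2 M) k (P : foliation M k) : Prop :=
  forall a : leaf P, lagrangian omega (@incl _ _ _ _ P a).

(** * Bohr-Sommerfeld quantization *)

Definition integral_leaf (R : realType) n (M : manifold R n)
    (L : line_bundle M) (D : connection L) k (P : foliation M k) : set (leaf P) :=
  [set a | trivial_along (@incl _ _ _ _ P a) D].
Arguments integral_leaf {R n M L} D {k} P _.

(* The complex vector space with basis A, as the subspace of T -> R[i]
   consisting of the finitely supported functions that vanish outside A; the
   basis vector of a in A is the indicator function of a. *)
Definition free_space (R : realType) (T : Type) (A : set T) : set (T -> R[i]) :=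
  [set f | finite_set [set a | f a != 0] /\ forall a, ~ A a -> f a = 0].

Lemma free_space_linear (R : realType) (T : Type) (A : set T) :
  free_space A (fun=> 0 : R[i]) /\
  forall (a : R[i]) f g, free_space A f -> free_space A g ->
    free_space A (fun x => a * f x + g x).
Proof.
split=> [|a f g [finf f0] [fing g0]].
  split=> //; rewrite (_ : [set _ | _] = set0) ?finite_set0 //.
  by apply/seteqP; split=> x //=; rewrite eqxx.
split; last by move=> x Ax; rewrite f0 // g0 // mulr0 addr0.
apply: (@sub_finite_set _ _ ([set x | f x != 0] `|` [set x | g x != 0])).
  move=> x /=; have [-> | ] := eqVneq (f x) 0; last by left.
  by rewrite mulr0 add0r; right.
by rewrite finite_setU.
Qed.

Definition BS_quantization (R : realType) n (M : manifold R n)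
    (L : line_bundle M) (D : connection L) k (P : foliation M k) :
    set (leaf P -> R[i]) :=
  free_space (integral_leaf D P).
Arguments BS_quantization {R n M L} D {k} P _.

(* Main.v *)
Require Import Defs.
From mathcomp Require Import all_boot all_order all_algebra.
From mathcomp Require Import all_classical all_reals all_analysis.
From mathcomp Require Import complex ring.
Set Implicit Arguments.
Unset Strict Implicit.
Unset Printing Implicit Defensive.
Import Order.TTheory GRing.Theory Num.Theory.
Import numFieldNormedType.Exports.
Local Open Scope classical_set_scope.
Local Open Scope ring_scope.
Local Open Scope complex_scope.

(** Two connections on L differ by a complex-valued 1-form, and if both preserve
    the metric this form has the shape i alpha with alpha real
    ([unitary_connections_form]). Passing from D to D' changes the curvature by
    i d(alpha) ([curvature_shift]); both curvatures being determined by omega,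
    alpha is closed, hence alpha = d(phi) for a global function phi because
    H^1(M, R) = 0.

    The gauge transformation exp(i phi) turns D' into D. Composed with a
    parallel trivialization Phi of (L, D) along a leaf, the unit function
    exp(i phi) pulled back to that leaf gives exp(i phi) Phi, a parallel
    trivialization of (L, D'); indeed
      d(exp(i phi) Phi s) = exp(i phi) (i d(phi) Phi s + Phi (D s))
    is the image of D' s ([exact_shift_trivial_along]). The roles of D and D'
    can be exchanged, so both connections have the same integral leaves, and the
    two quantizations have the same basis.

    The analytic input is that smoothness, understood as the existence of all
    iterated directional derivatives with differentiability at each stage, is
    local and stable under sums, products, sine, cosine and composition. *)

(** * Calculus of k-fold differentiable maps *)

(** Differentiability is defined by a global Landau equation for f, so its
    dependence on the germ of f alone needs a proof. *)
Lemma near_eq_differentiable (R : realType) (V W : normedModType R)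
    (f g : V -> W) (x : V) :
  {near x, f =1 g} -> differentiable f x -> differentiable g x.
Proof.
move=> fg df; have fgx := nbhs_singleton fg.
have gE : g \o shift x = cst (g x) + 'd f x +o_ (0 : V) id.
  apply/eqaddoP => eps eps0.
  have /eqaddoP/(_ _ eps0) fE := diff_locally df.
  have fg0 : \forall h \near (0 : V), f (h + x) = g (h + x).
    by move: fg; rewrite (near_shift 0 x); apply: filterS => h /=; rewrite subr0.
  by move: fE fg0; apply: filterS2 => h /= + fgh; rewrite !fctE /= /shift -fgh -fgx.
have dE := diff_unique (diff_continuous df) gE.
apply/diff_locallyP; rewrite dE; split=> //; exact: diff_continuous.
Qed.

Lemma open_near_eq (V : topologicalType) (W : Type) (U : set V) (f g : V -> W)
    (x : V) : open U -> U x -> {in U, f =1 g} -> {near x, f =1 g}.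
Proof.
move=> oU Ux fg; near=> y; apply: fg; rewrite inE.
by near: y; exact: open_nbhs_nbhs.
Unshelve. all: by end_near. Qed.

(** Openness of U is essential: the derivatives taken at each stage see the
    values of the function around each point of U. *)
Lemma eq_diff_n (R : realType) n (V : normedModType R) k (U : set 'rV[R]_n)
    (f g : 'rV[R]_n -> V) :
  open U -> {in U, f =1 g} -> diff_n k U f -> diff_n k U g.
Proof.
move=> oU; elim: k f g => //= k IH f g fg [df Df]; split=> [x Ux|v].
  exact: near_eq_differentiable (open_near_eq oU Ux fg) (df x Ux).
apply: IH (Df v) => x /[!inE] Ux.
exact/near_eq_derive/(open_near_eq oU Ux fg).
Qed.

(** The definition quantifies over the points of U separately, so the sets W
    may be arbitrary here, not only open. *)
Lemma diff_n_cover (R : realType) n (V : normedModType R) k (U : set 'rV[R]_n)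
    (f : 'rV[R]_n -> V) :
  (forall x, U x -> exists2 W, W x & diff_n k W f) -> diff_n k U f.
Proof.
elim: k f => //= k IH f H; split=> [x /H[W Wx [+ _]]|v]; first exact.
by apply: IH => x /H[W Wx [_ /(_ v)]]; exists W.
Qed.

Lemma diff_nW (R : realType) n (V : normedModType R) k (U : set 'rV[R]_n)
    (f : 'rV[R]_n -> V) : diff_n k.+1 U f -> diff_n k U f.
Proof. by elim: k f => // k IH f [df Df]; split=> // v; apply: IH. Qed.

Lemma diff_n_cst (R : realType) n (V : normedModType R) k (U : set 'rV[R]_n)
    (a : V) : diff_n k U (fun=> a).
Proof.
elim: k a => //= k IH a; split=> [x _|v]; first exact: differentiable_cst.
rewrite (_ : 'D_v _ = (fun=> 0)) //; apply/funext => x; exact: derive_cst.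
Qed.

Lemma diff_nD (R : realType) n (V : normedModType R) k (U : set 'rV[R]_n)
    (f g : 'rV[R]_n -> V) : open U ->
  diff_n k U f -> diff_n k U g -> diff_n k U (fun x => f x + g x).
Proof.
move=> oU; elim: k f g => //= k IH f g [df Df] [dg Dg]; split=> [x Ux|v].
  by apply: differentiableD; [exact: df|exact: dg].
apply: eq_diff_n (IH _ _ (Df v) (Dg v)) => // x /[!inE] Ux.
by rewrite deriveD //; apply: diff_derivable; [exact: df|exact: dg].
Qed.

Lemma diff_n_sum (R : realType) n (V : normedModType R) k (U : set 'rV[R]_n)
    m (f : 'I_m -> 'rV[R]_n -> V) : open U ->
  (forall i, diff_n k U (f i)) -> diff_n k U (fun x => \sum_i f i x).
Proof.
move=> oU Uf; pose F s := fun x => \sum_(i <- s) f i x.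
rewrite -/(F (index_enum _)); elim: (index_enum _) => [|i s IH].
  rewrite (_ : F _ = (fun=> 0)); first exact: diff_n_cst.
  by apply/funext => x; rewrite /F big_nil.
rewrite (_ : F _ = (fun x => f i x + F s x)); first exact: diff_nD.
by apply/funext => x; rewrite /F big_cons.
Qed.

Lemma diff_nM (R : realType) n k (U : set 'rV[R]_n)
    (f g : 'rV[R]_n -> R) : open U ->
  diff_n k U f -> diff_n k U g -> diff_n k U (fun x => f x * g x).
Proof.
move=> oU; elim: k f g => // k IH f g kf kg.
have [[df Df] [dg Dg]] := (kf, kg); split=> [x Ux|v].
  by apply: differentiableM; [exact: df|exact: dg].
apply: (@eq_diff_n _ _ _ _ _ (fun x => f x * 'D_v g x + g x * 'D_v f x)) => //.
  move=> x /[!inE] Ux.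
  by rewrite deriveM //; apply: diff_derivable; [exact: df|exact: dg].
apply: diff_nD => //; apply: IH; by [exact: diff_nW|exact: Df|exact: Dg].
Qed.

Lemma diff_nN (R : realType) n k (U : set 'rV[R]_n) (f : 'rV[R]_n -> R) :
  open U -> diff_n k U f -> diff_n k U (fun x => - f x).
Proof.
move=> oU kf; have := diff_nM oU (diff_n_cst k U (-1 : R)) kf.
by apply: eq_diff_n => // x _; rewrite mulN1r.
Qed.

Lemma derive_coord (R : realType) n m (F : 'rV[R]_n -> 'rV[R]_m) x v i :
  differentiable F x -> 'D_v (fun y => F y 0 i) x = 'D_v F x 0 i.
Proof. by move=> dF; rewrite derive_mx ?mxE //; exact: diff_derivable. Qed.

Lemma diff_n_coord (R : realType) n m k (U : set 'rV[R]_n)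
    (F : 'rV[R]_n -> 'rV[R]_m) i : open U ->
  diff_n k U F -> diff_n k U (fun x => F x 0 i).
Proof.
move=> oU; elim: k F => //= k IH F [dF DF]; split=> [x Ux|v].
  exact: (differentiable_comp (dF x Ux) (differentiable_coord _ _ _)).
apply: eq_diff_n (IH _ (DF v)) => // x /[!inE] Ux.
by rewrite derive_coord //; exact: dF.
Qed.

Lemma derive_comp (R : realType) (V W X : normedModType R) (f : V -> W)
    (g : W -> X) x v : differentiable f x -> differentiable g (f x) ->
  'D_v (g \o f) x = 'D_('D_v f x) g (f x).
Proof.
move=> df dg; rewrite !deriveE //; last exact: differentiable_comp.
by rewrite diff_comp.
Qed.

Lemma derive_row_sum (R : realType) (V : normedModType R) m
    (g : 'rV[R]_m -> V) y u : differentiable g y ->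
  'D_u g y = \sum_i u 0 i *: 'D_(delta_mx 0 i) g y.
Proof.
move=> dg; rewrite deriveE // [in LHS](row_sum_delta u) linear_sum.
by apply: eq_bigr => i _; rewrite linearZ deriveE.
Qed.

(** The chain rule writes each directional derivative of g o F as the sum of the
    products (D_v F)_i (d_i g o F). The induction hypothesis applies to d_i g,
    for the same F with one order of differentiability dropped. *)
Lemma diff_n_comp (R : realType) n m k (U : set 'rV[R]_n) (W : set 'rV[R]_m)
    (F : 'rV[R]_n -> 'rV[R]_m) (g : 'rV[R]_m -> R) : open U ->
  (forall x, U x -> W (F x)) ->
  diff_n k U F -> diff_n k W g -> diff_n k U (g \o F).
Proof.
move=> oU UW; elim: k g => // k IH g kF kg.
have [[dF DF] [dg Dg]] := (kF, kg); split=> [x Ux|v].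
  by apply: differentiable_comp; [exact: dF|exact/dg/UW].
pose h i x := 'D_v F x 0 i * ('D_(delta_mx 0 i) g \o F) x.
apply: (@eq_diff_n _ _ _ _ _ (fun x => \sum_i h i x)) => //.
  move=> x /[!inE] Ux; rewrite derive_comp; [|exact: dF|exact/dg/UW].
  by rewrite [RHS]derive_row_sum //; exact/dg/UW.
apply: diff_n_sum => // i; apply: diff_nM => //; first exact: diff_n_coord oU (DF v).
by apply: IH; [exact: diff_nW|exact: Dg].
Qed.

Lemma derive_comp1 (R : realType) (V : normedModType R) (f : V -> R)
    (g : R -> R) dg x v :
  differentiable f x -> is_derive (f x) 1 g dg ->
  'D_v (fun y => g (f y)) x = dg * 'D_v f x.
Proof.
move=> df dgx.
have gd : differentiable g (f x) by apply/derivable1_diffP.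
rewrite -[fun _ => _]/(g \o f) derive_comp // deriveE // -{1}['D_v f x]mulr1.
rewrite -[_ * 1]/(_ *: (1 : R)) linearZ /= -deriveE // derive_val.
by rewrite -[_ *: _]/(_ * _) mulrC.
Qed.

(** Sine and cosine are treated together because the derivative of each of them
    calls for the other at the previous order. *)
Lemma diff_n_cos_sin (R : realType) n k (U : set 'rV[R]_n)
    (f : 'rV[R]_n -> R) : open U -> diff_n k U f ->
  diff_n k U (fun x => cos (f x)) /\ diff_n k U (fun x => sin (f x)).
Proof.
move=> oU; elim: k => // k IH kf; have [ck sk] := IH (diff_nW kf).
have [df Df] := kf.
split; split=> [x Ux|v].
- apply: (differentiable_comp (f:=f)); first exact: df.
  by apply/derivable1_diffP; exact: derivable_cos.
- apply: (@eq_diff_n _ _ _ _ _ (fun x => - sin (f x) * 'D_v f x)) => //.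
    by move=> x /[!inE] Ux; rewrite (derive_comp1 v (df x Ux) (is_derive_cos _)).
  by apply: diff_nM => //; [exact: diff_nN|exact: Df].
- apply: (differentiable_comp (f:=f)); first exact: df.
  by apply/derivable1_diffP; exact: derivable_sin.
- apply: (@eq_diff_n _ _ _ _ _ (fun x => cos (f x) * 'D_v f x)) => //.
    by move=> x /[!inE] Ux; rewrite (derive_comp1 v (df x Ux) (is_derive_sin _)).
  by apply: diff_nM => //; exact: Df.
Qed.

(** * Smooth functions on a manifold and their differentials *)

(** The image is the part of the open set cimg c that the continuous map cinv c
    sends into V. *)
Lemma open_chart_image (R : realType) n (T : topologicalType)
    (c : chart R n T) (V : set T) :
  is_chart c -> open V -> open (cmap c @` (V `&` cdom c)).
Proof.
move=> [[oc oi] cK _ cc] oV; rewrite openE => _ [p [Vp cp] <-].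
have ip : cimg c (cmap c p) by exists p.
have Vn : nbhs (cinv c (cmap c p)) V by rewrite cK //; exact: open_nbhs_nbhs.
have Vn' : \forall y \near cmap c p, V (cinv c y) := cc _ ip _ Vn.
near=> y.
have [q cq qy] : cimg c y by near: y; exact: open_nbhs_nbhs.
exists q => //; split=> //; rewrite -(cK _ cq) qy; near: y; exact: Vn'.
Unshelve. all: by end_near. Qed.

Lemma open_atlas_image (R : realType) n (M : manifold R n) (c : chart R n M)
    (V : set M) : atlas M c -> open V -> open (cmap c @` (V `&` cdom c)).
Proof. by move=> Mc; apply: open_chart_image; exact: atlas_chart. Qed.

Lemma cinvK (R : realType) n (M : manifold R n) (c : chart R n M) p :
  atlas M c -> cdom c p -> cinv c (cmap c p) = p.
Proof. by move=> /atlas_chart[_ + _ _]; exact. Qed.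

Lemma smooth_on_cover (R : realType) n (M : manifold R n) (U : set M)
    (f : M -> R) :
  (forall p, U p -> exists2 W, W p & smooth_on W f) -> smooth_on U f.
Proof.
move=> H c Mc k; apply: diff_n_cover => _ [p [/H[W Wp Wf] cp] <-].
by exists (cmap c @` (W `&` cdom c)); [exists p|exact: Wf].
Qed.

Lemma sub_smooth_on (R : realType) n (M : manifold R n) (U W : set M)
    (f : M -> R) : U `<=` W -> smooth_on W f -> smooth_on U f.
Proof. by move=> UW Wf; apply: smooth_on_cover => p /UW; exists W. Qed.

Lemma eq_smooth_on (R : realType) n (M : manifold R n) (U : set M)
    (f g : M -> R) :
  open U -> {in U, f =1 g} -> smooth_on U f -> smooth_on U g.
Proof.
move=> oU fg Uf c Mc k; apply: eq_diff_n (Uf c Mc k).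
  exact: open_atlas_image.
move=> _ /[!inE] -[p [Up cp] <-] /=; rewrite cinvK //.
by apply: fg; rewrite inE.
Qed.

Lemma smooth_on_cst (R : realType) n (M : manifold R n) (U : set M) (a : R) :
  smooth_on U (fun=> a : R).
Proof. by move=> c Mc k; exact: diff_n_cst. Qed.

Lemma smooth_onD (R : realType) n (M : manifold R n) (U : set M)
    (f g : M -> R) : open U -> smooth_on U f -> smooth_on U g ->
  smooth_on U (fun p => f p + g p).
Proof.
move=> oU Uf Ug c Mc k.
exact: diff_nD (open_atlas_image Mc oU) (Uf c Mc k) (Ug c Mc k).
Qed.

Lemma smooth_onM (R : realType) n (M : manifold R n) (U : set M)
    (f g : M -> R) : open U -> smooth_on U f -> smooth_on U g ->
  smooth_on U (fun p => f p * g p).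
Proof.
move=> oU Uf Ug c Mc k.
exact: diff_nM (open_atlas_image Mc oU) (Uf c Mc k) (Ug c Mc k).
Qed.

Lemma smooth_onN (R : realType) n (M : manifold R n) (U : set M)
    (f : M -> R) : open U -> smooth_on U f -> smooth_on U (fun p => - f p).
Proof.
by move=> oU Uf c Mc k; exact: diff_nN (open_atlas_image Mc oU) (Uf c Mc k).
Qed.

Lemma smooth_on_cos_sin (R : realType) n (M : manifold R n) (U : set M)
    (f : M -> R) : open U -> smooth_on U f ->
  smooth_on U (fun p => cos (f p)) /\ smooth_on U (fun p => sin (f p)).
Proof.
move=> oU Uf; split=> c Mc k;
  by have [] := diff_n_cos_sin (open_atlas_image Mc oU) (Uf c Mc k).
Qed.

Lemma csmooth_on_cover (R : realType) n (M : manifold R n) (U : set M)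
    (f : M -> R[i]) :
  (forall p, U p -> exists2 W, W p & csmooth_on W f) -> csmooth_on U f.
Proof.
by move=> H; split; apply: smooth_on_cover => p /H[W Wp []]; exists W.
Qed.

Lemma sub_csmooth_on (R : realType) n (M : manifold R n) (U W : set M)
    (f : M -> R[i]) : U `<=` W -> csmooth_on W f -> csmooth_on U f.
Proof. by move=> UW Wf; apply: csmooth_on_cover => p /UW; exists W. Qed.

Lemma eq_csmooth_on (R : realType) n (M : manifold R n) (U : set M)
    (f g : M -> R[i]) :
  open U -> {in U, f =1 g} -> csmooth_on U f -> csmooth_on U g.
Proof.
by move=> oU fg [Uf Uf']; split; [move: Uf|move: Uf'];
  apply: eq_smooth_on => // p Up; rewrite fg.
Qed.

Lemma csmooth_onB (R : realType) n (M : manifold R n) (U : set M)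
    (f g : M -> R[i]) : open U -> csmooth_on U f -> csmooth_on U g ->
  csmooth_on U (fun p => f p - g p).
Proof.
move=> oU [Uf Uf'] [Ug Ug'].
have [B B'] := (smooth_onD oU Uf (smooth_onN oU Ug),
                smooth_onD oU Uf' (smooth_onN oU Ug')).
by split; [move: B|move: B']; apply: eq_smooth_on => // p _;
  case: (f p) (g p) => [a b] [a' b'].
Qed.

Lemma csmooth_onM (R : realType) n (M : manifold R n) (U : set M)
    (f g : M -> R[i]) : open U -> csmooth_on U f -> csmooth_on U g ->
  csmooth_on U (fun p => f p * g p).
Proof.
move=> oU [Uf Uf'] [Ug Ug'].
have B := smooth_onD oU (smooth_onM oU Uf Ug)
            (smooth_onN oU (smooth_onM oU Uf' Ug')).
have B' := smooth_onD oU (smooth_onM oU Uf Ug') (smooth_onM oU Uf' Ug).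
by split; [move: B|move: B']; apply: eq_smooth_on => // p _;
  case: (f p) (g p) => [a b] [a' b'].
Qed.

Lemma smooth_on_differentiable (R : realType) n (M : manifold R n)
    (U : set M) (f : M -> R) p : smooth_on U f -> U p ->
  differentiable (f \o cinv (chart_at p)) (cmap (chart_at p) p).
Proof.
move=> Uf Up; have [+ _] := Uf _ (chart_at_atlas p) 1%N; apply.
by exists p => //; split=> //; exact: chart_at_dom.
Qed.

Lemma cinv_near (R : realType) n (M : manifold R n) (c : chart R n M) p
    (A : set M) : atlas M c -> cdom c p -> nbhs p A ->
  \forall y \near cmap c p, A (cinv c y).
Proof.
move=> Mc cp Ap; have [_ cK _ cc] := atlas_chart Mc.
by apply: cc; [exists p|rewrite cK].
Qed.

Lemma near_cmapK (R : realType) n (M : manifold R n) (c : chart R n M) p :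
  atlas M c -> cdom c p -> \forall y \near cmap c p, cmap c (cinv c y) = y.
Proof.
move=> Mc cp; have [[oc oi] cK _ _] := atlas_chart Mc; near=> y.
have [q cq <-] : cimg c y by near: y; apply: open_nbhs_nbhs; split=> //; exists p.
by rewrite cK.
Unshelve. all: by end_near. Qed.

Lemma coord_field_chart_at (R : realType) n (M : manifold R n) (p : M) v :
  coord_field (chart_at p) v p = v.
Proof.
rewrite -[RHS](@derive_id _ _ (cmap (chart_at p) p)).
apply: near_eq_derive; apply: near_cmapK.
  exact: chart_at_atlas.
exact: chart_at_dom.
Qed.

Lemma dfun_cst (R : realType) n (M : manifold R n) (a : R) (p : M) v :
  dfun (fun=> a) p v = 0.
Proof. exact: derive_cst. Qed.

Lemma dfunD (R : realType) n (M : manifold R n) (U : set M) (f g : M -> R) p v :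
  smooth_on U f -> smooth_on U g -> U p ->
  dfun (fun q => f q + g q) p v = dfun f p v + dfun g p v.
Proof.
move=> Uf Ug Up; rewrite /dfun -deriveD //; apply: diff_derivable;
  [exact: smooth_on_differentiable Uf Up|exact: smooth_on_differentiable Ug Up].
Qed.

Lemma dfunM (R : realType) n (M : manifold R n) (U : set M) (f g : M -> R) p v :
  smooth_on U f -> smooth_on U g -> U p ->
  dfun (fun q => f q * g q) p v = dfun f p v * g p + f p * dfun g p v.
Proof.
move=> Uf Ug Up; rewrite /dfun [LHS]deriveM; first last.
- exact: diff_derivable (smooth_on_differentiable Ug Up).
- exact: diff_derivable (smooth_on_differentiable Uf Up).
rewrite /= cinvK; [|exact: chart_at_atlas|exact: chart_at_dom].
by rewrite -![_ *: _]/(_ * _) addrC mulrC.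
Qed.

Lemma cdfunM (R : realType) n (M : manifold R n) (U : set M)
    (f g : M -> R[i]) p v : open U ->
  csmooth_on U f -> csmooth_on U g -> U p ->
  cdfun (fun q => f q * g q) p v = cdfun f p v * g p + f p * cdfun g p v.
Proof.
move=> oU [Uf Uf'] [Ug Ug'] Up; rewrite /cdfun.
have reM (a b : R[i]) : complex.Re (a * b) =
    complex.Re a * complex.Re b + - (complex.Im a * complex.Im b).
  by case: a b => [a a'] [b b'].
have imM (a b : R[i]) : complex.Im (a * b) =
    complex.Re a * complex.Im b + complex.Im a * complex.Re b.
  by case: a b => [a a'] [b b'].
have NE (F : M -> R) : (fun q => - F q) = (fun q => -1 * F q).
  by apply/funext => q; rewrite mulN1r.
under eq_fun do rewrite reM.
under [fun q : M => complex.Im _]eq_fun do rewrite imM.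
rewrite (dfunD _ (smooth_onM oU Uf Ug) (smooth_onN oU (smooth_onM oU Uf' Ug'))) //.
rewrite NE (dfunM _ (smooth_on_cst U _) (smooth_onM oU Uf' Ug')) // dfun_cst.
rewrite (dfunD _ (smooth_onM oU Uf Ug') (smooth_onM oU Uf' Ug)) //.
rewrite (dfunM _ Uf Ug) // (dfunM _ Uf' Ug') // (dfunM _ Uf Ug') //.
rewrite (dfunM _ Uf' Ug) //.
case: (f p) (g p) => [a a'] [b b'] /=; simpc.
by congr (_ +i* _); ring.
Qed.

(** Continuity of f is what allows the insertion of the chart c' of the target
    on a whole neighbourhood. *)
Lemma near_chart_factor (R : realType) m n (N : manifold R m) (M : manifold R n)
    (f : N -> M) (phi : M -> R) (c : chart R m N) (c' : chart R n M) q :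
  continuous f -> atlas N c -> atlas M c' -> cdom c q -> cdom c' (f q) ->
  {near cmap c q, phi \o f \o cinv c =1
     (phi \o cinv c') \o (cmap c' \o f \o cinv c)}.
Proof.
move=> cf Nc Mc' cq c'fq.
apply: (cinv_near (A := [set r | (phi \o f) r =
  (phi \o cinv c' \o cmap c' \o f) r]) Nc cq).
have [[oc' _] _ _ _] := atlas_chart Mc'.
have : nbhs q (f @^-1` cdom c') by apply: cf; exact: open_nbhs_nbhs.
by apply: filterS => r fr /=; rewrite cinvK.
Qed.

Lemma dfun_comp (R : realType) m n (N : manifold R m) (M : manifold R n)
    (f : N -> M) (phi : M -> R) q w : smooth_map f -> smooth_on setT phi ->
  dfun (phi \o f) q w = dfun phi (f q) (dmap f q w).
Proof.
move=> [cf sf] sphi.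
have Nq := (chart_at_atlas q, chart_at_dom q).
have Mq := (chart_at_atlas (f q), chart_at_dom (f q)).
rewrite /dfun (near_eq_derive _ (near_chart_factor _ cf Nq.1 Mq.1 Nq.2 Mq.2)).
rewrite derive_comp /= ?cinvK; try by [exact: Nq.1|exact: Nq.2].
- by [].
- have [+ _] := sf _ _ Nq.1 Mq.1 1%N; apply; exists q => //.
  by split; [exact: Nq.2|exact: Mq.2].
- exact: smooth_on_differentiable sphi I.
Qed.

Lemma smooth_on_comp (R : realType) m n (N : manifold R m) (M : manifold R n)
    (f : N -> M) (phi : M -> R) : smooth_map f -> smooth_on setT phi ->
  smooth_on setT (phi \o f).
Proof.
move=> [cf sf] sphi; apply: smooth_on_cover => q _.
pose c' := @chart_at _ _ M (f q); have Mc' : atlas M c' := chart_at_atlas _.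
have [[oc' _] _ _ _] := atlas_chart Mc'.
exists (f @^-1` cdom c'); first exact: chart_at_dom.
have oV : open (f @^-1` cdom c') by apply: open_comp => // r _; exact: cf.
move=> c Nc k.
have oW : open (cmap c @` ((f @^-1` cdom c') `&` cdom c)).
  exact: open_atlas_image.
apply: (@eq_diff_n _ _ _ _ _ ((phi \o cinv c') \o (cmap c' \o f \o cinv c))) => //.
  by move=> _ /[!inE] -[r [/= c'fr cr] <-]; rewrite cinvK //= cinvK.
apply: (@diff_n_comp _ _ _ _ _ (cmap c' @` (setT `&` cdom c'))) => //.
- move=> _ [r [/= c'fr cr] <-]; rewrite cinvK //; exists (f r) => //; split=> //.
- have := sf _ _ Nc Mc' k; rewrite setIC; exact.
- exact: sphi.
Qed.

(** * Local frames of a line bundle *)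

Definition frame (R : realType) n (M : manifold R n) (L : preline M)
  (j : tidx L) : section L := fun p => trivinv j p 1.

Lemma frame_smooth (R : realType) n (M : manifold R n) (L : line_bundle M)
    (j : tidx L) : smooth_section (tdom j) (frame j).
Proof. by move=> j'; exact: triv_smooth (line_ax L) j j'. Qed.

Lemma triv_scale (R : realType) n (M : manifold R n) (L : line_bundle M)
    (j : tidx L) p : tdom j p -> forall a (x : L p),
  triv j p (a *: x) = a * triv j p x.
Proof.
move=> jp a x; have lin := triv_linear (line_ax L) jp.
have t0 : triv j p 0 = 0 by rewrite -(addNr x) -scaleN1r lin mulN1r addNr.
by rewrite -[a *: x]addr0 lin t0 addr0.
Qed.

Lemma trivB (R : realType) n (M : manifold R n) (L : line_bundle M)
    (j : tidx L) p : tdom j p -> forall x y : L p,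
  triv j p (x - y) = triv j p x - triv j p y.
Proof.
move=> jp x y; rewrite addrC -scaleN1r (triv_linear (line_ax L) jp).
by rewrite mulN1r addrC.
Qed.

Lemma triv_frame (R : realType) n (M : manifold R n) (L : line_bundle M)
    (j : tidx L) p : tdom j p -> triv j p (frame j p) = 1.
Proof. by move=> jp; rewrite (trivinvK (line_ax L) jp). Qed.

Lemma frameE (R : realType) n (M : manifold R n) (L : line_bundle M)
    (j : tidx L) p (x : L p) : tdom j p -> x = triv j p x *: frame j p.
Proof.
move=> jp; apply: (can_inj (trivK (line_ax L) jp)).
by rewrite triv_scale // triv_frame // mulr1.
Qed.

Lemma frame_neq0 (R : realType) n (M : manifold R n) (L : line_bundle M)
    (j : tidx L) p : tdom j p -> frame j p != 0.
Proof.
move=> jp; apply/eqP => e0; have := triv_frame jp.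
rewrite e0 -[0](scale0r (frame j p)) triv_scale // mul0r.
by move=> /esym/eqP; rewrite oner_eq0.
Qed.

Lemma sub_smooth_section (R : realType) n (M : manifold R n) (L : preline M)
    (U W : set M) (s : section L) :
  U `<=` W -> smooth_section W s -> smooth_section U s.
Proof. by move=> UW Ws j; apply: sub_csmooth_on (Ws j); exact: setSI. Qed.

Lemma smooth_sectionZ (R : realType) n (M : manifold R n) (L : line_bundle M)
    (U : set M) (f : M -> R[i]) (s : section L) : open U ->
  csmooth_on U f -> smooth_section U s -> smooth_section U (fun q => f q *: s q).
Proof.
move=> oU Uf Us j; have oW := openI oU (tdom_open (line_ax L) j).
have Wf : csmooth_on (U `&` tdom j) f by apply: sub_csmooth_on Uf => q [].
apply: eq_csmooth_on (csmooth_onM oW Wf (Us j)) => // q /[!inE] -[_ jq].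
by rewrite triv_scale.
Qed.

(** * The 1-form that separates two connections *)

(** The coefficient of (D' - D) e on e for a local frame e around p; it does not
    depend on e, by [connection_diffE]. *)
Definition connection_diff (R : realType) n (M : manifold R n)
    (L : line_bundle M) (D D' : connection L) (p : M) (v : 'rV[R]_n) : R[i] :=
  let j := triv_at L p in triv j p (D' (frame j) p v - D (frame j) p v).

(** In the Leibniz rule for s = g e the term dg is the same for D and D', so the
    difference is linear over functions and computed on the frame e. *)
Lemma connection_diffE (R : realType) n (M : manifold R n) (L : line_bundle M)
    (D D' : connection L) (U : set M) (s : section L) p v :
  open U -> U p -> smooth_section U s ->
  D' s p v = D s p v + connection_diff D D' p v *: s p.
Proof.
move=> oU Up Us; rewrite /connection_diff; set j := triv_at L p.
have jp : tdom j p := triv_at_dom (line_ax L) p.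
pose g q := triv j q (s q); pose W := U `&` tdom j.
have oW : open W by apply: openI oU (tdom_open (line_ax L) j).
have DE (E : connection L) : E s p v =
    cdfun g p v *: frame j p + g p *: E (frame j) p v.
  rewrite -(@nabla_leibniz _ _ _ _ E W) //; last 2 first.
  - exact: Us.
  - by apply: sub_smooth_section (frame_smooth (L:=L) j) => q [].
  apply: (@nabla_local _ _ _ _ E W) => //.
    by apply: sub_smooth_section Us => q [].
  by move=> q [_ jq]; exact: frameE.
rewrite !DE -addrA; congr (_ + _).
rewrite [X in _ + _ *: X](frameE _ jp) -/(g p) scalerA mulrC -scalerA -frameE //.
by rewrite -scalerDr subrKC.
Qed.

Lemma connection_diff_linear (R : realType) n (M : manifold R n)
    (L : line_bundle M) (D D' : connection L) p (a : R) u v :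
  connection_diff D D' p (a *: u + v) =
  a%:C * connection_diff D D' p u + connection_diff D D' p v.
Proof.
rewrite /connection_diff; set j := triv_at L p.
have jp : tdom j p := triv_at_dom (line_ax L) p.
have lin (E : connection L) := nabla_linear E a u v
  (tdom_open (line_ax L) j) jp (frame_smooth (L:=L) j).
by rewrite !lin !trivB // !(triv_linear (line_ax L) jp); ring.
Qed.

(** Near p the form can be computed with the single frame given by the
    trivialization around p, although its definition uses a frame that varies
    with the point. *)
Lemma connection_diff_smooth (R : realType) n (M : manifold R n)
    (L : line_bundle M) (D D' : connection L) (c : chart R n M) v : atlas M c ->
  csmooth_on (cdom c) (fun p => connection_diff D D' p (coord_field c v p)).
Proof.
move=> Mc; apply: csmooth_on_cover => p cp; pose j := triv_at L p.
have jp : tdom j p := triv_at_dom (line_ax L) p.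
have oj : open (tdom j) := tdom_open (line_ax L) j.
have [[oc _] _ _ _] := atlas_chart Mc.
pose W := (tdom j `&` cdom c) `&` tdom j.
have oW : open W by do 2!apply: openI => //.
have WD (E : connection L) :
    csmooth_on W (fun q => triv j q (E (frame j) q (coord_field c v q))).
  exact: (nabla_smooth E v oj Mc (frame_smooth (L:=L) j) j).
exists W => //; apply: eq_csmooth_on (csmooth_onB oW (WD D') (WD D)) => //.
move=> q /[!inE] -[[jq _] _]; rewrite -trivB //.
rewrite (connection_diffE D D' _ oj jq (frame_smooth (L:=L) j)) addrC addKr.
by rewrite triv_scale // triv_frame // mulr1.
Qed.

(** With A the value of the form at v and e a frame, metric compatibility of
    both connections leaves (A + conj A) h(e, e) = 0, and h(e, e) > 0. *)
Lemma connection_diff_Re (R : realType) n (M : manifold R n)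
    (L : line_bundle M) (h : hermitian_metric L) (D D' : connection L) p v :
  unitary h D -> unitary h D' -> complex.Re (connection_diff D D' p v) = 0.
Proof.
move=> hD hD'; pose j := triv_at L p; set A := connection_diff _ _ _ _.
have jp : tdom j p := triv_at_dom (line_ax L) p.
have oj : open (tdom j) := tdom_open (line_ax L) j.
have sj := frame_smooth (L:=L) j.
have := hD' _ _ _ _ v oj jp sj sj; rewrite (hD _ _ _ _ v oj jp sj sj).
rewrite (connection_diffE D D' v oj jp sj) -/A addrC.
set e := frame j p; set d := D _ p v.
rewrite [h p e (_ + _)]herm_conj [d + _]addrC herm_linear [h p e d]herm_conj.
rewrite rmorphD rmorphM /= -(herm_conj h e e) => /eqP.
rewrite -subr_eq0 => /eqP hE.
have : (A + A^*) * h p e e = 0 by rewrite -[RHS]oppr0 -hE; ring.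
move=> /eqP; rewrite mulf_eq0 orbC.
rewrite (gt_eqF (herm_pos _ (frame_neq0 jp))) /=.
by case: A {hE} => a b /eqP[/eqP]; rewrite -mulr2n mulrn_eq0 => /eqP.
Qed.

Lemma unitary_connections_form (R : realType) n (M : manifold R n)
    (L : line_bundle M) (h : hermitian_metric L) (D D' : connection L) :
  unitary h D -> unitary h D' ->
  exists alpha : form1 M, forall U (s : section L) p v,
    open U -> U p -> smooth_section U s ->
    D' s p v = D s p v + (0 +i* alpha p v) *: s p.
Proof.
move=> hD hD'; pose A := connection_diff D D'.
have lin p (a : R) u v : complex.Im (A p (a *: u + v)) =
    a * complex.Im (A p u) + complex.Im (A p v).
  rewrite /A connection_diff_linear.
  by case: connection_diff (connection_diff _ _ _ v) => [x y] [x' y']; simpc.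
have smo c v : atlas M c ->
    smooth_on (cdom c) (fun p => complex.Im (A p (coord_field c v p))).
  by move=> Mc; have [] := connection_diff_smooth D D' v Mc.
exists (Form1 lin smo) => U s p v oU Up Us /=.
rewrite (connection_diffE D D' v oU Up Us); congr (_ + _ *: _).
have := connection_diff_Re p v hD hD'.
by rewrite -/(A p v); case: (A p v) => a b /= ->.
Qed.

(** Expanding D' = D + i alpha twice leaves, besides the curvature of D and the
    derivatives of alpha, terms that are symmetric in u and v: they cancel in
    the antisymmetrization. There is no alpha wedge alpha term since L has
    rank one. *)
Lemma curvature_shift (R : realType) n (M : manifold R n)
    (L : line_bundle M) (D D' : connection L) (alpha : form1 M) :
  (forall U (s : section L) p v, open U -> U p -> smooth_section U s ->
    D' s p v = D s p v + (0 +i* alpha p v) *: s p) ->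
  forall U (s : section L) p u v, open U -> U p -> smooth_section U s ->
  curvature D' s p u v = curvature D s p u v + (0 +i* extd1 alpha p u v) *: s p.
Proof.
move=> DD' U s p u v oU Up Us; pose c := @chart_at _ _ M p.
have Mc : atlas M c := chart_at_atlas p; have cp : cdom c p := chart_at_dom p.
have [[oc _] _ _ _] := atlas_chart Mc.
pose W := U `&` cdom c; have oW : open W by exact: openI.
have Ws : smooth_section W s by apply: sub_smooth_section Us => q [].
have DDs w z : D' (fun q => D' s q (coord_field c w q)) p z =
    D (fun q => D s q (coord_field c w q)) p z
    + (0 +i* dfun (fun q => alpha q (coord_field c w q)) p z) *: s p
    + (0 +i* alpha p w) *: D s p z + (0 +i* alpha p z) *: D s p w
    + (0 +i* alpha p z) * (0 +i* alpha p w) *: s p.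
  pose a q : R[i] := 0 +i* alpha q (coord_field c w q).
  have Wa : csmooth_on W a.
    split; first exact: smooth_on_cst.
    by apply: sub_smooth_on (form1_smooth alpha w Mc) => q [].
  have WDs (E : connection L) :
      smooth_section W (fun q => E s q (coord_field c w q)).
    by have := nabla_smooth E w oU Mc Us.
  have D'E : {in W, forall q, D' s q (coord_field c w q) =
      D s q (coord_field c w q) + a q *: s q}.
    by move=> q /[!inE] -[Uq _]; exact: DD' oU Uq Us.
  rewrite (DD' W _ p z) // D'E ?inE //.
  rewrite (@nabla_local _ _ _ _ D W _
    (fun q => D s q (coord_field c w q) + a q *: s q)) //; last first.
    by move=> q Wq; apply: D'E; rewrite inE.
  rewrite (@nabla_add _ _ _ _ D W) //; last exact: smooth_sectionZ.
  rewrite (@nabla_leibniz _ _ _ _ D W) //.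
  rewrite /a /cdfun /= dfun_cst coord_field_chart_at scalerDr scalerA.
  by rewrite !addrA.
(* z and y stand for the cross terms, t for the quadratic term in alpha *)
have cancel5 (x a x' a' y z t : L p) :
    x + a + y + z + t - (x' + a' + z + y + t) = x - x' + (a - a').
  rewrite -[x + a + y + z]addrA -[x' + a' + z + y]addrA [z + y]addrC.
  by do 2!rewrite opprD addrACA subrr addr0; rewrite opprD addrACA.
have imB (x y : R) : (0 +i* x) - (0 +i* y) = 0 +i* (x - y) :> R[i] by simpc.
rewrite /curvature (DDs v u) (DDs u v) (mulrC (0 +i* alpha p v)) cancel5 -scalerBl.
by rewrite imB.
Qed.

(** * Gauge transformation along a leaf *)

(** A D-parallel trivialization multiplied by the unit function exp(i phi o f)
    is D'-parallel, because the derivative of this factor is the pullback of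
    i d(phi) times the factor itself. *)
Lemma exact_shift_trivial_along (R : realType) m n (N : manifold R m)
    (M : manifold R n) (f : N -> M) (L : line_bundle M) (D D' : connection L)
    (phi : M -> R) :
  smooth_map f -> smooth_on setT phi ->
  (forall U (s : section L) p v, open U -> U p -> smooth_section U s ->
    D' s p v = D s p v + (0 +i* dfun phi p v) *: s p) ->
  trivial_along f D -> trivial_along f D'.
Proof.
move=> sf sphi DD' [Phi [Plin Pbij Psm PD]].
have spf : smooth_on setT (phi \o f) := smooth_on_comp sf sphi.
(* z is exp(i phi) along f, and z' its inverse *)
pose z q : R[i] := cos (phi (f q)) +i* sin (phi (f q)).
pose z' q : R[i] := cos (phi (f q)) -i* sin (phi (f q)).
have zz' q : z q * z' q = 1.
  rewrite /z /z'; simpc; rewrite -!expr2 cos2Dsin2.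
  by rewrite [sin _ * _]mulrC addrC subrr.
have [sc ss] := smooth_on_cos_sin openT spf.
have sz : csmooth_on setT z by [].
have sz' : csmooth_on setT z' by split=> //; exact: smooth_onN openT ss.
have trivS U (s : section (trivial_line N)) :
    smooth_section U s <-> csmooth_on U s.
  by split=> [/(_ tt)|Us j]; rewrite /= setIT.
have dz q w : cdfun z q w = (0 +i* dfun (phi \o f) q w) * z q.
  have dpf := smooth_on_differentiable spf (I : setT q).
  rewrite /cdfun /dfun /=.
  rewrite (derive_comp1 w dpf (is_derive_cos _)).
  rewrite (derive_comp1 w dpf (is_derive_sin _)) /=.
  rewrite cinvK; [|exact: chart_at_atlas|exact: chart_at_dom].
  by rewrite /z; simpc; rewrite [sin _ * _]mulrC [cos _ * _]mulrC.
exists (fun q x => z q * Phi q x); split.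
- have lin (b a x y : R[i]) : b * (a * x + y) = a * (b * x) + b * y by ring.
  by move=> q a x y; rewrite Plin; exact: (lin (z q) a (Phi q x) (Phi q y)).
- move=> q; have [g Pg gP] := Pbij q; exists (fun x => g (z' q * x)) => x.
    by rewrite mulrA [z' q * _]mulrC zz' mul1r Pg.
  by rewrite gP mulrA zz' mul1r.
- move=> U s oU; rewrite Psm // !trivS; split=> Us.
    by apply: csmooth_onM => //; exact: sub_csmooth_on sz.
  apply: (@eq_csmooth_on _ _ _ _ (fun q => z' q * (z q * Phi q (s q)))) => //.
    by move=> q _; rewrite mulrA [z' q * _]mulrC zz' mul1r.
  by apply: csmooth_onM => //; exact: sub_csmooth_on sz'.
move=> U s q w oU Uq Us.
have /Psm/trivS UPs := Us.
rewrite [RHS](cdfunM w oU _ (UPs oU) Uq); last exact: sub_csmooth_on sz.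
have -> : pullback_connection D' s q w =
    pullback_connection D s q w + (0 +i* dfun (phi \o f) q w) *: s q.
  rewrite /pullback_connection; set j := triv_at L (f q).
  have jq : tdom j (f q) := triv_at_dom (line_ax L) (f q).
  have oj : open (tdom j) := tdom_open (line_ax L) j.
  rewrite (DD' _ _ _ _ oj jq (frame_smooth (L:=L) j)) -dfun_comp //.
  rewrite scalerDr addrA; congr (_ + _).
  by rewrite scalerA mulrC -scalerA -frameE.
have key (b c x d : R[i]) : b * (c * x + d) = c * b * x + b * d by ring.
rewrite addrC Plin (PD U s q w oU Uq Us) dz.
exact: (key (z q) _ (Phi q (s q)) (cdfun (fun r => Phi r (s r)) q w)).
Qed.

(** This carries the proof: equality of curvatures makes the separating form
    closed, and the vanishing of H^1 provides the phase of the gauge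
    transformation. *)
Lemma sub_integral_leaf (R : realType) n k (M : manifold R n)
    (omega : form2 M) (L : line_bundle M) (h : hermitian_metric L)
    (P : foliation M k) (D D' : connection L) : H1_zero M ->
  unitary h D -> unitary h D' -> curv_eq D omega -> curv_eq D' omega ->
  integral_leaf D P `<=` integral_leaf D' P.
Proof.
move=> H1M hD hD' cD cD' a.
have [alpha DD'] := unitary_connections_form hD hD'.
have [p u v|phi sphi alphaE] := H1M alpha.
  pose j := triv_at L p.
  have jp : tdom j p := triv_at_dom (line_ax L) p.
  have oj : open (tdom j) := tdom_open (line_ax L) j.
  have sj := frame_smooth (L:=L) j.
  have i2pi : (0 +i* 1) / (2 * pi)%:C != 0 :> R[i].
    rewrite mulf_neq0 ?invr_neq0 //; first by rewrite eq_complex /= oner_eq0 andbF.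
    by rewrite eq_complex /= eqxx andbT mulf_neq0 // gt_eqF ?pi_gt0.
  have := cD' _ _ _ u v oj jp sj; rewrite -(cD _ _ _ u v oj jp sj).
  move=> /(scalerI i2pi); rewrite (curvature_shift DD' u v oj jp sj).
  move/(canRL (addKr _)); rewrite addNr => /eqP; rewrite scaler_eq0.
  by rewrite (negbTE (frame_neq0 jp)) orbF eq_complex /= eqxx => /eqP.
apply: exact_shift_trivial_along sphi _.
  by case: (@incl_immersion _ _ _ _ P a).
by move=> U s p v oU Up Us; rewrite -alphaE; exact: DD' oU Up Us.
Qed.

Theorem corollary2 (R : realType) (n k : nat) (M : manifold R n)
    (omega : form2 M) (omega_symplectic : symplectic omega)
    (H1M : H1_zero M)
    (L : line_bundle M) (h : hermitian_metric L) (c1L : c1_eq L omega)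
    (P : foliation M k) (P_polarization : real_polarization omega P)
    (D D' : connection L) (D_unitary : unitary h D) (D'_unitary : unitary h D')
    (D_prequantum : prequantum omega D) (D'_prequantum : prequantum omega D') :
  BS_quantization D P = BS_quantization D' P.
Proof.
have [_ cD] := D_prequantum; have [_ cD'] := D'_prequantum.
congr free_space; apply/seteqP; split.
  exact: sub_integral_leaf H1M D_unitary D'_unitary cD cD'.
exact: sub_integral_leaf H1M D'_unitary D_unitary cD' cD.
Qed.
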